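(* Let $A(z)=a_3z^3+a_2z^2+a_1z+a_0$ and $B(z)=b_3z^3+b_2z^2+b_1z+b_0$ be polynomials with complex coefficients (of degree at most three), and let $w$ be a positive weight function on $[0,2\pi]$ satisfying the Pearson-type equation $$\frac{d}{d\theta}\left[A(e^{i\theta})w(\theta)\right]=B(e^{i\theta})w(\theta),\qquad 0\le\theta\le 2\pi .$$ If $A(1)[w(2\pi)-w(0)]=0$, then the monic orthogonal polynomials $\Phi_n$ on the unit circle with respect to $w(\theta)d\theta$ satisfy, for every $n\ge 3$, $$A(z)\Phi_n'(z)=na_3\Phi_{n+2}(z)+\mathfrak{s}_{n,n+1}\Phi_{n+1}(z)+\mathfrak{s}_{n,n}\Phi_n(z)+\mathfrak{s}_{n,n-1}\Phi_{n-1}(z)+[\mathfrak{p}_{n,n}z+\mathfrak{t}_{n,n}]\Phi_n^{*}(z),$$ where $$\mathfrak{p}_{n,n}=(ib_3+2a_3)\overline{\alpha}_n,$$ $$\mathfrak{t}_{n,n}=(ib_3+a_3)\overline{\alpha}_{n+1}(1-|\alpha_n|^2)+(ib_2+a_2+a_3\ell_{n+1,n})\overline{\alpha}_n,$$ $$\mathfrak{s}_{n,n-1}=(ib_0+na_0)(1-|\alpha_{n-1}|^2),$$ $$\mathfrak{s}_{n,n}=ib_1+(n+1)a_1-a_0\overline{\ell}_{n,n-1}-[ib_0+(n+1)a_0]\alpha_n\overline{\alpha}_{n-1},$$ $$\mathfrak{s}_{n,n+1}=na_2+a_3[(n-1)\ell_{n,n-1}-n\ell_{n+2,n+1}]+(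ib_3+2a_3)\overline{\alpha}_n\alpha_{n-1}.$$
   Context: Inner product: $\langle f,g\rangle=\int_0^{2\pi}f(e^{i\theta})\overline{g(e^{i\theta})}\,w(\theta)\,d\theta$. $\{\Phi_n\}_{n\ge0}$ is the sequence of monic orthogonal polynomials, $\deg\Phi_n=n$, $\langle\Phi_n,\Phi_m\rangle=0$ for $n\ne m$, written $\Phi_n(z)=z^n+\ell_{n,n-1}z^{n-1}+\cdots+\ell_{n,1}z+\ell_{n,0}$. The reversed polynomial is $\Phi_n^*(z)=z^n\overline{\Phi_n(1/\overline z)}$. Verblunsky coefficients: $\alpha_{n-1}=-\overline{\ell}_{n,0}=-\overline{\Phi_n(0)}$ for $n\ge1$, and $\alpha_{-1}=-1$. Prime denotes $d/dz$. The Pearson equation is understood with $\theta\mapsto A(e^{i\theta})w(\theta)$ absolutely continuous on $[0,2\pi]$ and the equation holding almost everywhere; $A(1)[w(2\pi)-w(0)]$ denotes the difference of the boundary values of $A(e^{i\theta})w(\theta)$ at $2\pi$ and $0$. *)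

(* Defs.v *)
From mathcomp Require Import all_boot all_order all_algebra.
From mathcomp Require Import all_classical all_reals all_analysis.
From mathcomp Require Import complex.

Set Implicit Arguments.
Unset Strict Implicit.
Unset Printing Implicit Defensive.

Import Order.TTheory GRing.Theory Num.Theory.
Import numFieldNormedType.Exports.

Local Open Scope classical_set_scope.
Local Open Scope ring_scope.
Local Open Scope complex_scope.

Lemma horner_rev_morph (C : fieldType) (f : {rmorphism C -> C}) n
    (p : {poly C}) z :
    involutive f -> (size p <= n.+1)%N -> z != 0 ->
  (\poly_(k < n.+1) f p`_(n - k)).[z] = z ^+ n * f p.[(f z)^-1].
Proof.
move=> fK sp z0; rewrite horner_poly (horner_coef_wide _ sp) rmorph_sum.
rewrite mulr_sumr (reindex_inj rev_ord_inj); apply: eq_bigr => k _.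
have le_kn : (k <= n)%N by rewrite -ltnS.
rewrite /= subSS subKn // rmorphM rmorphXn fmorphV fK.
rewrite mulrCA; congr (_ * _).
by rewrite exprVn -expfB_cond ?(negPf z0).
Qed.

Section Definitions.
Context {R : realType}.
Implicit Types (w : R -> R) (F : R -> R[i]) (p : {poly R[i]}).

Definition expi (theta : R) : R[i] := cos theta +i* sin theta.

Definition cintegral (D : set R) F : R[i] :=
  (\int[lebesgue_measure]_(t in D) complex.Re (F t)) +i*
  (\int[lebesgue_measure]_(t in D) complex.Im (F t)).

(* R[i] is not a normed module over R in the library, so the derivative of a
   complex-valued function of a real variable is taken componentwise. *)
Definition is_cderive F (t : R) (d : R[i]) : Prop :=
  is_derive t 1 (fun s => complex.Re (F s)) (complex.Re d) /\
  is_derive t 1 (fun s => complex.Im (F s)) (complex.Im d).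

Definition absolutely_continuous_on (a b : R) F : Prop :=
  forall e : R, 0 < e -> exists2 d : R, 0 < d &
    forall (n : nat) (u v : 'I_n -> R),
      (forall k, a <= u k /\ u k <= v k /\ v k <= b) ->
      trivIset setT (fun k => [set x | u k < x < v k]) ->
      \sum_(k < n) (v k - u k) < d ->
      \sum_(k < n) `|F (v k) - F (u k)| < e%:C.

(* Positivity is required almost everywhere only, so that weights vanishing at
   isolated points of the circle are included. *)
Definition weight w : Prop :=
  lebesgue_measure.-integrable `[0, 2 * pi] (EFin \o w) /\
  {ae lebesgue_measure, forall theta, `[0, 2 * pi]%classic theta -> 0 < w theta}.

Definition inner w (f g : R[i] -> R[i]) : R[i] :=
  cintegral `[0, 2 * pi]
    (fun theta => f (expi theta) * (g (expi theta))^*%C * (w theta)%:C).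

Definition monic_OPUC w (Phi : nat -> {poly R[i]}) : Prop :=
  (forall n, Phi n \is monic /\ size (Phi n) = n.+1) /\
  (forall n m, n != m -> inner w (horner (Phi n)) (horner (Phi m)) = 0).

Definition pearson (A B : {poly R[i]}) w : Prop :=
  let Aw theta := A.[expi theta] * (w theta)%:C in
  absolutely_continuous_on 0 (2 * pi) Aw /\
  {ae lebesgue_measure, forall theta, `[0, 2 * pi]%classic theta ->
     is_cderive Aw theta (B.[expi theta] * (w theta)%:C)}.

(* The reversed polynomial of degree n; see [horner_reversed]. *)
Definition reversed (n : nat) p : {poly R[i]} :=
  \poly_(k < n.+1) (p`_(n - k))^*%C.

Lemma horner_reversed n p (z : R[i]) : (size p <= n.+1)%N -> z != 0 ->
  (reversed n p).[z] = z ^+ n * (p.[(z^*%C)^-1])^*%C.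
Proof. exact: (@horner_rev_morph R[i] (@conjc R) n p z (@conjcK R)). Qed.

(* The index starts at 0: the conventional value -1 at index -1 is omitted. *)
Definition verblunsky (Phi : nat -> {poly R[i]}) (n : nat) : R[i] :=
  - ((Phi n.+1).[0])^*%C.

End Definitions.

(* Main.v *)
Require Import Defs.
From mathcomp Require Import all_boot all_order all_algebra.
From mathcomp Require Import all_classical all_reals all_analysis.
From mathcomp Require Import complex.
From mathcomp Require Import measurable_realfun zify ring lra.

(* Integrating (A w g)' over the circle for g = e^(i(m-k-1)theta), where the
   boundary terms cancel by periodicity, turns the Pearson equation into
     <A f', z^k> = <((k+1) A + i B) f, z^(k+1)>   for every polynomial f.
   With f = Phi_n the right-hand side vanishes for 2 <= k <= n-2, so A Phi_n'
   is orthogonal to z^2, ..., z^(n-2). The polynomials on the right of the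
   claimed identity have the same property, and their coefficients are exactly
   those for which the difference of the two sides has degree at most n and is
   also orthogonal to z^k for k = 0, 1, n-1, n; these inner products are
   computed from the Szego recursion. A polynomial of degree at most n
   orthogonal to 1, ..., z^n is orthogonal to itself, hence zero. *)

Set Implicit Arguments.
Unset Strict Implicit.
Unset Printing Implicit Defensive.

Import Order.TTheory GRing.Theory Num.Theory.
Import numFieldNormedType.Exports.

Local Open Scope classical_set_scope.
Local Open Scope ring_scope.
Local Open Scope complex_scope.

(** * Real absolutely continuous functions whose derivative vanishes almost everywhere *)

Section RealAC.
Context {R : realType}.
Notation mu := (@lebesgue_measure R).
Implicit Types (a b : R) (F G H f g : R -> R).

Definition real_AC a b F : Prop :=
  forall e : R, 0 < e -> exists2 d : R, 0 < d &
    forall (n : nat) (u v : 'I_n -> R),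
      (forall k, a <= u k /\ u k <= v k /\ v k <= b) ->
      trivIset setT (fun k => [set x | u k < x < v k]) ->
      \sum_(k < n) (v k - u k) < d ->
      \sum_(k < n) `|F (v k) - F (u k)| < e.

(** Prepared for real induction, which adds one interval at a time on the right: a list ordered from
    right to left grows at its head, and the order gives disjointness. *)
Lemma real_AC_seq a b F (e : R) : real_AC a b F -> 0 < e ->
  exists2 d : R, 0 < d & forall s : seq (R * R),
    {in s, forall p, a <= p.1 /\ p.1 <= p.2 /\ p.2 <= b} ->
    pairwise (fun p q => q.2 <= p.1) s ->
    \sum_(p <- s) (p.2 - p.1) < d ->
    \sum_(p <- s) `|F p.2 - F p.1| < e.
Proof.
move=> acF e0; have [d d0 dF] := acF _ e0; exists d => // s sab srt sd.
have x0 : R * R := (0, 0).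
rewrite (big_nth x0) big_mkord.
apply: (dF _ (fun k => (nth x0 s k).1) (fun k => (nth x0 s k).2)).
- by move=> k; apply: sab; exact: mem_nth.
- move=> i j _ _ [x []] /= /andP[ix xi] /andP[jx xj]; apply: val_inj => /=.
  move/(pairwiseP x0) : srt => srt.
  case: (ltngtP i j) => // ij.
  + have := srt i j (ltn_ord i) (ltn_ord j) ij => h.
    by have := lt_trans ix (lt_le_trans xj h); rewrite ltxx.
  + have := srt j i (ltn_ord j) (ltn_ord i) ij => h.
    by have := lt_trans jx (lt_le_trans xi h); rewrite ltxx.
- by move: sd; rewrite (big_nth x0) big_mkord.
Qed.

(** The head is the rightmost interval; its half-open version []p.1, p.2]] is disjoint from the part
    of [U] up to [p.1], to which induction applies for the tail. *)
Lemma sum_length_le_measure (U : set R) (s : seq (R * R)) (x : R) :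
  measurable U ->
  {in s, forall p, p.1 <= p.2 /\ p.2 <= x /\ `[p.1, p.2] `<=` U} ->
  pairwise (fun p q => q.2 <= p.1) s ->
  ((\sum_(p <- s) (p.2 - p.1))%:E <= mu (U `&` `]-oo, x]))%E.
Proof.
move=> mU; elim: s x => [|p s IH] x sU /=; first by rewrite big_nil.
move=> /andP[ps srt]; rewrite big_cons EFinD.
have [p12 [px pU]] := sU p (mem_head _ _).
apply: (@le_trans _ _ (mu (`]p.1, p.2] `|` (U `&` `]-oo, p.1])))); last first.
  apply: le_measure; rewrite ?inE.
  - by apply: measurableU => //; exact: measurableI.
  - exact: measurableI.
  - move=> y [|[Uy]] /=; rewrite !in_itv/=.
      move=> /andP[py yp]; split; last exact: le_trans px.
      by apply: pU; rewrite /= in_itv/= yp ltW.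
    by move=> yp; split => //; rewrite (le_trans yp)// (le_trans p12).
rewrite measureU//; last 2 first.
- exact: measurableI.
- apply/seteqP; split => // y [/=]; rewrite !in_itv/= => /andP[py _] [_].
  by rewrite leNgt py.
apply: leeD.
  by rewrite [leRHS]lebesgue_measure_itv/= lte_fin; case: ltP => //= h;
    rewrite lee_fin; lra.
apply: IH => // q qs; have [q12 [_ qU]] := sU q (mem_behead (s := p :: s) qs).
by split => //; split => //; move/allP : ps => /(_ _ qs).
Qed.

(* Real induction: outside an open set of small measure containing the
   exceptional points, H grows at rate at most e; inside, absolute continuity
   controls the increments. *)
Lemma real_AC_derive0 a b H : a <= b -> real_AC a b H ->
  {ae mu, forall x, `[a, b]%classic x -> is_derive x 1 H 0} -> H b = H a.
Proof.
move=> ab acH [N [mN N0 HN]].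
(* Used at e / (b - a + 1), for which the right-hand side equals e. *)
suff main e : 0 < e -> `|H b - H a| <= e * (b - a) + e.
  apply/eqP; rewrite -subr_eq0 -normr_le0; apply/ler_addgt0Pl => e e0.
  rewrite addr0.
  have h0 : 0 < b - a + 1 by rewrite ltr_wpDl// subr_ge0.
  have := main (e / (b - a + 1)) (divr_gt0 e0 h0).
  by rewrite -{2}[e / _]mulr1 -mulrDr divfK// gt_eqF.
move=> e0.
have [d d0 dH] := real_AC_seq acH e0.
have [|U [oU NU mUd]] := @lebesgue_regularity_outer R N d mN _ d0.
  by rewrite [X in (X < _)%E]N0.
have mU := open_measurable oU.
have Ud : (mu U < d%:E)%E.
  rewrite -(setDUK NU); apply: le_lt_trans (measureU2 _ _ _) _ => //.
    exact: measurableD.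
  by rewrite [X in (X + _)%E]N0 add0e.
(* Points up to which the increment of [H] is covered by slope [e] plus the increments over ordered
   intervals inside [U]. The goal is [S b]. *)
pose S := [set x | a <= x <= b /\ exists2 s : seq (R * R),
  {in s, forall p, [/\ a <= p.1, p.1 <= p.2, p.2 <= x & `[p.1, p.2] `<=` U]} /\
  pairwise (fun p q => q.2 <= p.1) s &
  `|H x - H a| <= e * (x - a) + \sum_(p <- s) `|H p.2 - H p.1|].
have Sa : S a.
  split; first by rewrite lexx.
  by exists [::]; [split | rewrite !subrr normr0 mulr0 add0r big_nil].
have supS : has_sup S.
  by split; [exists a | exists b => x [/andP[]]].
pose c := sup S.
have ac : a <= c by apply: ub_le_sup => //; exact: supS.2.
have cb : c <= b by apply: ge_sup => [|x [/andP[]]//]; exists a.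
have step x y : x <= y -> a <= y <= b -> S x ->
    `|H y - H x| <= e * (y - x) \/ `[x, y] `<=` U -> S y.
  move=> xy ayb [/andP[ax xb] [s [sx srt] Hs]] [Hxy|xyU]; split => //.
    exists s.
      split => // p /sx [p1 p2 p3 p4]; split => //; exact: le_trans xy.
    rewrite (_ : H y - H a = (H y - H x) + (H x - H a)); last by lra.
    by apply: le_trans (ler_normD _ _) _; lra.
  exists ((x, y) :: s).
    split => [p|/=].
      rewrite in_cons => /predU1P[->//|/sx [p1 p2 p3 p4]].
      by split => //; exact: le_trans xy.
    by rewrite srt andbT; apply/allP => p /sx[].
  rewrite big_cons/=.
  rewrite (_ : H y - H a = (H y - H x) + (H x - H a)); last by lra.
  apply: le_trans (ler_normD _ _) _.
  have : e * (x - a) <= e * (y - a) by rewrite ler_pM2l// lerB.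
  lra.
(* If the supremum [c] is exceptional, [U] contains a neighbourhood of it; otherwise the derivative
   at [c] is 0 and the Caratheodory quotient stays below [e] nearby. *)
have [dl dl0 loc] : exists2 dl, 0 < dl & forall x y, x <= c -> c <= y ->
    c - dl < x -> y < c + dl -> a <= x -> y <= b ->
    `|H y - H x| <= e * (y - x) \/ `[x, y] `<=` U.
  have [cN|cN] := pselect (N c).
    have /nbhs_ballP[dl /= dl0 dlU] : nbhs c U by apply: open_nbhs_nbhs;
      split => //; exact: NU.
    exists dl => // x y xc cy xdl ydl _ _; right => z /=;
      rewrite in_itv/= => /andP[xz zy].
    by apply: dlU; rewrite /ball/= ltr_norml; apply/andP; split; lra.
  have [drv Hc] : is_derive c 1 H 0.
    by apply: contrapT => h; apply: cN; apply: HN => /= /(_ _);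
      apply: contra_not h; apply; rewrite /= in_itv/= ac cb.
  have /is_derive1_caratheodory [h [Hh ch h0]] := DeriveDef drv Hc.
  have [dl /= dl0 dlh] : nbhs c [set x | `|h x| < e].
    move/cvgr_dist_lt : ch => /(_ _ e0); apply: filterS => z /=.
    by rewrite h0 sub0r normrN.
  have near_c x : `|c - x| < dl -> `|H x - H c| <= e * `|x - c|.
    move=> xc; rewrite Hh normrM ler_wpM2r// ltW//.
    exact: dlh.
  exists dl => // x y xc cy xdl ydl _ _; left.
  rewrite (_ : H y - H x = (H y - H c) - (H x - H c)); last by lra.
  apply: le_trans (ler_normB _ _) _.
  rewrite (_ : y - x = `|y - c| + `|x - c|); last first.
    by rewrite ger0_norm ?ler0_norm; lra.
  by rewrite mulrDr lerD// near_c// ltr_norml; apply/andP; split; lra.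
(* Some element of [S] lies within [dl] of [c], and one step leads from it to [c]. *)
have Sc : S c.
  have [x Sx] := @sup_adherent _ _ dl dl0 supS.
  rewrite -/c => cx.
  have xc : x <= c by apply: ub_le_sup => //; exact: supS.2.
  apply: (step x) => //; first by rewrite ac cb.
  apply: loc => //; first by lra.
  by case: Sx => /andP[].
(* If c < b, one more step would produce a point of [S] beyond its supremum. *)
have Sb : S b.
  have [|cb'] := leP b c; first by move=> bc; rewrite (_ : b = c)//;
    apply/eqP; rewrite eq_le bc cb.
  pose y := Num.min b (c + dl / 2).
  have cy : c < y by rewrite lt_min cb' ltrDl divr_gt0.
  have yb : y <= b by rewrite ge_min lexx.
  have yd : y < c + dl by rewrite gt_min; apply/orP; right; lra.
  have Sy : S y.
    apply: (step c) => //; first exact: ltW.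
      by rewrite yb (le_trans ac)// ltW.
    apply: loc => //; [exact: ltW|lra].
  by have := ub_le_sup supS.2 Sy; rewrite leNgt cy.
have [_ [s [sx srt] Hs]] := Sb.
(* The intervals of [s] lie in [U], so their total length is below [d] and the increments over them
   sum to less than [e]. *)
apply: (le_trans Hs); rewrite lerD2l ltW//; apply: dH => //.
  by move=> p /sx[].
rewrite -lte_fin; apply: le_lt_trans Ud.
apply: le_trans (sum_length_le_measure (U := U) (x := b) mU _ srt) _.
  by move=> p /sx[].
by apply: le_measure; rewrite ?inE//; exact: measurableI.
Qed.

End RealAC.

(** * The fundamental theorem of calculus for absolutely continuous functions, and products with
    smooth factors *)

Section FTC_AC.
Context {R : realType}.
Notation mu := (@lebesgue_measure R).
Implicit Types (a b K M : R) (F G H f g : R -> R).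

Lemma real_ACD a b F G : real_AC a b F -> real_AC a b G ->
  real_AC a b (fun x => F x + G x).
Proof.
move=> acF acG e e0; have e20 : 0 < e / 2 by lra.
have [d1 d10 H1] := acF _ e20; have [d2 d20 H2] := acG _ e20.
exists (Num.min d1 d2); first by rewrite lt_min d10.
move=> n u v uv tuv; rewrite lt_min.
move=> /andP[/(H1 _ _ _ uv tuv) h1 /(H2 _ _ _ uv tuv) h2].
apply: (@le_lt_trans _ _
  (\sum_(k < n) (`|F (v k) - F (u k)| + `|G (v k) - G (u k)|))).
  apply: ler_sum => k _;
    rewrite (_ : _ - _ = (F (v k) - F (u k)) + (G (v k) - G (u k))).
    exact: ler_normD.
  by ring.
by rewrite big_split/=; lra.
Qed.

(** The increment of F G splits as (F v - F u) G v + F u (G v - G u): absolute continuity of [F]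
    bounds the first term, M K (v - u) the second. The summand 1 in M K + 1 avoids a zero
    divisor. *)
Lemma real_ACM_lipschitz a b F G M K : 0 <= M -> 0 <= K ->
  (forall x, a <= x <= b -> `|F x| <= M) ->
  (forall x, `|G x| <= 1) -> (forall x y, `|G y - G x| <= K * `|y - x|) ->
  real_AC a b F -> real_AC a b (fun x => F x * G x).
Proof.
move=> M0 K0 FM G1 GK acF e e0; have e20 : 0 < e / 2 by lra.
have [d1 d10 H1] := acF _ e20.
have MK : 0 < M * K + 1 by rewrite ltr_wpDl// mulr_ge0.
exists (Num.min d1 (e / 2 / (M * K + 1))); first by rewrite lt_min d10 divr_gt0.
move=> n u v uv tuv; rewrite lt_min => /andP[/(H1 _ _ _ uv tuv) h1].
rewrite ltr_pdivlMr// => h2.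
apply: (@le_lt_trans _ _
  (\sum_(k < n) (`|F (v k) - F (u k)| + M * K * (v k - u k)))).
  apply: ler_sum => k _; have [au [uvk vb]] := uv k.
  rewrite (_ : _ - _ =
    (F (v k) - F (u k)) * G (v k) + F (u k) * (G (v k) - G (u k)));
    last by ring.
  apply: le_trans (ler_normD _ _) _; rewrite !normrM lerD//.
    by rewrite ler_piMr.
  rewrite -mulrA ler_pM//; first by apply: FM; rewrite au (le_trans uvk).
  by rewrite (le_trans (GK _ _))// ger0_norm// subr_ge0.
rewrite big_split/= -mulr_sumr.
have : 0 <= \sum_(k < n) (v k - u k).
  by apply: sumr_ge0 => k _; rewrite subr_ge0; have [_ []] := uv k.
by lra.
Qed.

Lemma real_ACN a b F : real_AC a b F -> real_AC a b (fun x => - F x).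
Proof.
move=> acF e e0; have [d d0 dF] := acF _ e0; exists d => // n u v uv tuv h.
apply: le_lt_trans (dF _ _ _ uv tuv h); apply: ler_sum => k _.
by rewrite -opprD normrN.
Qed.

Lemma real_AC_sub a b b' F : b' <= b -> real_AC a b F -> real_AC a b' F.
Proof.
move=> bb acF e e0; have [d d0 dF] := acF _ e0; exists d => // n u v uv.
apply: dF => k; have [h1 [h2 h3]] := uv k; split => //; split => //.
exact: le_trans bb.
Qed.

(* Split f into a bounded (continuous) part and a part of small L1 norm. *)
Lemma real_AC_integral a b f : a <= b ->
  mu.-integrable `[a, b] (EFin \o f) ->
  real_AC a b (fun x => \int[mu]_(t in `[a, x]) f t).
Proof.
move=> ab intf e e0.
have mab : measurable `[a, b]%classic by [].
have fab : (mu `[a, b]%classic < +oo)%E.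
  by rewrite /= lebesgue_measure_itv/=; case: ifP => //= _; rewrite -EFinB ltry.
have [h_ [ch ih /fine_cvgP[]]] := approximation_continuous_integrable mab fab
  intf.
move=> hfin /cvgr_dist_lt /(_ _ (divr_gt0 e0 (ltr0n _ 2))) hcvg.
have [N _ /(_ N (leqnn N)) /=] := hcvg.
move: (ch N) (ih N) => {}ch {}ih; set h := h_ N in ch ih *.
rewrite sub0r normrN => hN.
have [M M0 hM] : exists2 M, 0 < M & forall x, a <= x <= b -> `|h x| <= M.
  have : compact (h @` `[a, b]%classic).
    apply: continuous_compact; last exact: segment_compact.
    exact: continuous_subspaceT.
  move=> /compact_bounded[M [_ hM]]; exists (Num.max M 1 + 1).
    by rewrite addr_gt0// lt_max ltr01 orbT.
  move=> x xab; apply: hM; last by exists x.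
  by rewrite ltr_pwDr// le_max lexx.
(* From |f| <= |f - h| + M on [a, b]: the bound [M] costs M times the total length, the difference
   at most the L1 distance of [f] and [h], each below e / 2. *)
exists (e / 2 / M); first by rewrite !divr_gt0.
move=> n u v uv tuv; rewrite ltr_pdivlMr// => sd.
have subI k : `]u k, v k[ `<=` `[a, b].
  have [au [uvk vb]] := uv k.
  move=> x /=; rewrite !in_itv/= => /andP[ux xv].
  by rewrite (le_trans au) ?(ltW ux)// (le_trans _ vb)// ltW.
have intfh : mu.-integrable `[a, b] (EFin \o (fun x => f x - h x)).
  rewrite (_ : _ \o _ = (EFin \o f) \- (EFin \o h))%E; last first.
    by apply/funext => x /=; rewrite EFinB.
  exact: integrableB.
have intn := integrable_norm intfh.
have intM : mu.-integrable `[a, b] (EFin \o cst M).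
  apply: continuous_compact_integrable; first exact: segment_compact.
  by apply: continuous_subspaceT => x; exact: cst_continuous.
have onI k (g : R -> \bar R) :
    mu.-integrable `[a, b] g -> mu.-integrable `]u k, v k[ g.
  by move=> ig; apply: integrableS ig.
have bound k :
    `|\int[mu]_(t in `[a, v k]) f t - \int[mu]_(t in `[a, u k]) f t| <=
    \int[mu]_(t in `]u k, v k[) `|f t - h t| + M * (v k - u k).
  have [au [uvk vb]] := uv k.
  have intv : mu.-integrable `]u k, v k[ (EFin \o f) by apply: onI.
  rewrite Rintegral_itvB ?bnd_simp//; last first.
    apply: integrableS intf => //; apply: subset_itvl; by rewrite bnd_simp.
  rewrite -Rintegral_itv_bndo_bndc//.
  apply: le_trans (le_normr_Rintegral _ _) _ => //.
  apply: (@le_trans _ _ (\int[mu]_(t in `]u k, v k[) (`|f t - h t| + M))).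
    apply: le_Rintegral => //.
    - exact: integrable_norm.
    - rewrite (_ : _ \o _ = (EFin \o (fun t => `|f t - h t|)%R) \+ cst
      M%:E)%E//.
      by apply: integrableD => //; exact: onI.
    - move=> x /subI /=; rewrite in_itv/= => /hM hx.
      by rewrite -lerBlDl; apply: le_trans hx; rewrite lerBlDl;
        apply: le_trans (ler_normD _ _); rewrite subrK.
  rewrite RintegralD//; [|exact: onI..].
  rewrite lerD2l Rintegral_cst// ler_pM2l// [X in fine X]lebesgue_measure_itv/=
    lte_fin.
  by case: ltP => //= _; rewrite subr_ge0.
apply: le_lt_trans (ler_sum _ (fun k _ => bound k)) _.
rewrite big_split/= -mulr_sumr.
suff : \sum_(k < n) \int[mu]_(t in `]u k, v k[) `|f t - h t| < e / 2 by lra.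
apply: le_lt_trans (le_lt_trans (ler_norm _) hN).
rewrite /Rintegral sum_fine; last by move=> k _;
  apply: integrable_fin_num => //; exact: onI.
(* Disjointness merges the integrals into a single one over [J], which is contained in [a, b]. *)
pose J := \big[setU/set0]_(k < n) `]u k, v k[%classic.
have mJ : measurable J by apply: bigsetU_measurable.
have JI : J `<=` `[a, b] by rewrite /J;
  elim/big_ind : _ => // X Y XI YI x [/XI|/YI].
have mJf : measurable_fun J (fun x => `|(f x - h x)%:E|%E).
  by apply: measurable_funS (measurable_int mu intn).
have := @ge0_integral_bigsetU _ _ _ mu 'I_n (fun k => `]u k, v k[%classic) _
  (index_enum 'I_n).
move=> /(_ (fun x => `|(f x - h x)%:E|%E)) <- //; last 2 first.
- exact: index_enum_uniq.
- by apply: sub_trivIset tuv.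
apply: fine_le.
- by apply: integrable_fin_num => //; apply: integrableS intn.
- exact: integrable_fin_num intn.
- by apply: ge0_subset_integral => //; exact: measurable_int intn.
Qed.

(** [F] minus the indefinite integral of [f] is absolutely continuous with derivative 0 almost
    everywhere, so [real_AC_derive0] makes its values at [a] and [b] agree. *)
Lemma real_AC_FTC a b F f : a <= b -> real_AC a b F ->
  mu.-integrable `[a, b] (EFin \o f) ->
  {ae mu, forall x, `[a, b]%classic x -> is_derive x 1 F (f x)} ->
  \int[mu]_(t in `[a, b]) f t = F b - F a.
Proof.
move=> ab acF intf aeF.
(* Extension by zero provides the integrability on every [a, y] that [FTC1] asks for. *)
pose g := f \_ `[a, b].
have gE x : `[a, b]%classic x -> g x = f x by move=> xab;
  rewrite /g patchE mem_set.
have intgT : mu.-integrable setT (EFin \o g).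
  have /integrable_mkcond := intf; rewrite restrict_EFin; exact.
have intg D : measurable D -> mu.-integrable D (EFin \o g).
  by move=> mD; apply: integrableS intgT.
pose G x := \int[mu]_(t in `[a, x]) g t.
have acG : real_AC a b G by apply: real_AC_integral => //; exact: intg.
have aeG : {ae mu, forall x, `[a, b]%classic x -> is_derive x 1 G (f x)}.
  have := @FTC1 R g (BLeft a) (fun y => intg _ (measurable_itv _))
    (integrable_locally_restrict (measurable_itv _) intf).
  (* [FTC1] gives the derivative only to the right of [a]; a single point is null. *)
  have nea : {ae mu, forall x, x != a}.
    exists [set a]; split;
      [exact: measurable_set1|exact: lebesgue_measure_set1|].
    by move=> x /= /negP; rewrite negbK => /eqP.
  move: nea; rewrite -/G; apply: filterS2;
    first exact: (ae_filter_ringOfSetsType mu).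
  move=> x xa Gx xab.
  have [|dG] := Gx.
    by move: xab; rewrite /= in_itv/= lte_fin lt_neqAle eq_sym xa => /andP[].
  by rewrite derive1E gE// => <-; exact: DeriveDef.
have : F b - G b = F a - G a.
  apply: (@real_AC_derive0 _ a b (fun x => F x - G x)) => //.
    exact: real_ACD acF (real_ACN acG).
  move: aeF aeG; apply: filterS2; first exact: (ae_filter_ringOfSetsType mu).
  move=> x Fx Gx xab.
  have {}Fx := Fx xab; have {}Gx := Gx xab.
  by apply: is_derive_eq; rewrite subrr.
have -> : G a = 0 by rewrite /G set_itv1 Rintegral_set1.
have -> : G b = \int[mu]_(t in `[a, b]) f t.
  by apply: eq_Rintegral => x; rewrite inE => /gE.
by lra.
Qed.

(** [real_AC_FTC] on [a, x] writes F x as F a plus an integral of [f], which the L1 norm of [f]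
    bounds. *)
Lemma real_AC_bounded a b F f : real_AC a b F ->
  mu.-integrable `[a, b] (EFin \o f) ->
  {ae mu, forall x, `[a, b]%classic x -> is_derive x 1 F (f x)} ->
  exists2 M, 0 <= M & forall x, a <= x <= b -> `|F x| <= M.
Proof.
move=> acF intf aeF.
exists (`|F a| + \int[mu]_(t in `[a, b]) `|f t|).
  by rewrite addr_ge0// Rintegral_ge0.
move=> x /andP[ax xb].
have sub : `[a, x] `<=` `[a, b] by apply: subset_itvl; rewrite bnd_simp.
have intfx : mu.-integrable `[a, x] (EFin \o f) by apply: integrableS intf.
have FE : \int[mu]_(t in `[a, x]) f t = F x - F a.
  apply: real_AC_FTC => //; first exact: real_AC_sub xb acF.
  move: aeF; apply: filterS; first exact: (ae_filter_ringOfSetsType mu).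
  by move=> y h /sub.
rewrite -(subrK (F a) (F x)) addrC -FE.
apply: le_trans (ler_normD _ _) _; rewrite lerD2l.
apply: le_trans (le_normr_Rintegral _ _) _ => //.
have intn := integrable_norm intf.
apply: fine_le.
- by apply: integrable_fin_num => //; apply: integrableS intn.
- exact: integrable_fin_num intn.
- by apply: ge0_subset_integral => //; exact: measurable_int intn.
Qed.

(** By the mean value theorem the bound on [g] makes [G] Lipschitz, so [real_ACM_lipschitz] applies;
    the derivative is the product rule. *)
Lemma real_ACM_smooth a b F f G g K : a <= b -> 0 <= K ->
  real_AC a b F -> mu.-integrable `[a, b] (EFin \o f) ->
  {ae mu, forall x, `[a, b]%classic x -> is_derive x 1 F (f x)} ->
  (forall x, `|G x| <= 1) -> (forall x, `|g x| <= K) ->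
  (forall x : R, is_derive x 1 G (g x)) ->
  real_AC a b (fun x => F x * G x) /\
  {ae mu, forall x, `[a, b]%classic x ->
    is_derive x 1 (fun x => F x * G x) (f x * G x + F x * g x)}.
Proof.
move=> ab K0 acF intf aeF G1 gK dG; split.
  have [M M0 FM] := real_AC_bounded acF intf aeF.
  apply: (@real_ACM_lipschitz _ _ _ _ M K) => //.
  suff GK x y : x < y -> `|G y - G x| <= K * `|y - x|.
    move=> x y; have [xy|yx|->] := ltgtP x y; first exact: GK.
      by rewrite distrC [X in _ <= _ * X]distrC; exact: GK.
    by rewrite !subrr normr0 mulr0.
  move=> xy; have [] := @MVT _ G g x y xy.
  - by apply: derivable_within_continuous => z _; have dGz := dG z;
    exact: ex_derive.
  - by move=> z _ ->; rewrite normrM ler_wpM2r.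
move: aeF; apply: filterS; first exact: (ae_filter_ringOfSetsType mu).
move=> x Fx xab; have {}Fx := Fx xab; have Gx := dG x.
by apply: is_derive_eq; rewrite /GRing.scale/=; ring.
Qed.

End FTC_AC.

(** * Continuity, integrability and integrals of complex-valued functions, by components *)

Section ComplexIntegral.
Context {R : realType}.
Notation mu := (@lebesgue_measure R).
Local Notation C := R[i].
Implicit Types (F G g : R -> C) (x y z : C).

Lemma cReD x y : complex.Re (x + y) = complex.Re x + complex.Re y.
Proof. by case: x y => ? ? []. Qed.
Lemma cImD x y : complex.Im (x + y) = complex.Im x + complex.Im y.
Proof. by case: x y => ? ? []. Qed.
Lemma cReM x y : complex.Re (x * y) =
  complex.Re x * complex.Re y - complex.Im x * complex.Im y.
Proof. by case: x y => ? ? []. Qed.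
Lemma cImM x y : complex.Im (x * y) =
  complex.Re x * complex.Im y + complex.Im x * complex.Re y.
Proof. by case: x y => ? ? []. Qed.
Lemma cReJ x : complex.Re (x^*)%C = complex.Re x.
Proof. by case: x. Qed.
Lemma cImJ x : complex.Im (x^*)%C = - complex.Im x.
Proof. by case: x. Qed.

Lemma cDJ (x y : R[i]) : (x + y)^*%C = x^*%C + y^*%C.
Proof. exact: rmorphD. Qed.
Lemma cNJ (x : R[i]) : (- x)^*%C = - x^*%C.
Proof. exact: rmorphN. Qed.
Lemma cMJ (x y : R[i]) : (x * y)^*%C = x^*%C * y^*%C.
Proof. exact: rmorphM. Qed.
Lemma cXJ (x : R[i]) k : (x ^+ k)^*%C = x^*%C ^+ k.
Proof. exact: rmorphXn. Qed.

Definition ccontinuous g :=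
  continuous (fun t => complex.Re (g t)) /\
  continuous (fun t => complex.Im (g t)).

Lemma ccontinuous_cst x : ccontinuous (fun=> x).
Proof. by split; exact: cst_continuous. Qed.

Lemma ccontinuousD F G : ccontinuous F -> ccontinuous G ->
  ccontinuous (fun t => F t + G t).
Proof.
move=> [F1 F2] [G1 G2]; split => t.
  under eq_fun do rewrite cReD; apply: cvgD; [exact: F1|exact: G1].
under eq_fun do rewrite cImD; apply: cvgD; [exact: F2|exact: G2].
Qed.

Lemma ccontinuousM F G : ccontinuous F -> ccontinuous G ->
  ccontinuous (fun t => F t * G t).
Proof.
move=> [F1 F2] [G1 G2]; split => t.
  under eq_fun do rewrite cReM; apply: cvgB; apply: cvgM;
  [exact: F1|exact: G1|exact: F2|exact: G2].
under eq_fun do rewrite cImM; apply: cvgD; apply: cvgM;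
  [exact: F1|exact: G2|exact: F2|exact: G1].
Qed.

Lemma ccontinuousJ F : ccontinuous F -> ccontinuous (fun t => (F t)^*%C).
Proof.
move=> [F1 F2]; split => t; first by under eq_fun do rewrite cReJ; exact: F1.
by under eq_fun do rewrite cImJ; apply: cvgN; exact: F2.
Qed.

Lemma ccontinuous_expi : ccontinuous expi.
Proof. by split; [exact: continuous_cos|exact: continuous_sin]. Qed.

Lemma ccontinuous_horner (p : {poly C}) : ccontinuous (fun t => p.[expi t]).
Proof.
elim/poly_ind: p => [|p c IH].
  by under eq_fun do rewrite horner0; exact: ccontinuous_cst.
under eq_fun do rewrite hornerMXaddC.
apply: ccontinuousD; last exact: ccontinuous_cst.
apply: ccontinuousM => //; exact: ccontinuous_expi.
Qed.

Definition cintegrable (D : set R) F :=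
  mu.-integrable D (fun t => (complex.Re (F t))%:E) /\
  mu.-integrable D (fun t => (complex.Im (F t))%:E).

Lemma eq_cintegral (D : set R) F G : (forall t, D t -> F t = G t) ->
  cintegral D F = cintegral D G.
Proof.
by move=> FG; rewrite /cintegral; congr (_ +i* _); apply: eq_Rintegral => t;
  rewrite inE => /FG ->.
Qed.

Section Domain.
Variable D : set R.
Hypothesis mD : measurable D.

Lemma cintegralD F G : cintegrable D F -> cintegrable D G ->
  cintegral D (fun t => F t + G t) = cintegral D F + cintegral D G.
Proof.
move=> [F1 F2] [G1 G2]; rewrite /cintegral.
under eq_Rintegral do rewrite cReD.
under [X in _ +i* X]eq_Rintegral do rewrite cImD.
by rewrite !RintegralD.
Qed.

Lemma cintegralZ z F : cintegrable D F ->
  cintegral D (fun t => z * F t) = z * cintegral D F.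
Proof.
case: z => a b [F1 F2]; rewrite /cintegral.
under eq_Rintegral do rewrite cReM.
under [X in _ +i* X]eq_Rintegral do rewrite cImM.
have Z k (f : R -> R) : mu.-integrable D (EFin \o f) ->
    mu.-integrable D (EFin \o (fun t => k * f t)).
  by move=> intf; rewrite (_ : _ \o _ = (fun t => k%:E * (f t)%:E)%E)//;
    exact: integrableZl.
by rewrite RintegralB ?RintegralD ?RintegralZl//; exact: Z.
Qed.

Lemma cintegralJ F : cintegrable D F ->
  cintegral D (fun t => (F t)^*%C) = (cintegral D F)^*%C.
Proof.
move=> [F1 F2]; rewrite /cintegral.
under eq_Rintegral do rewrite cReJ.
under [X in _ +i* X]eq_Rintegral do rewrite cImJ -mulN1r.
by rewrite RintegralZl// mulN1r.
Qed.
End Domain.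

Lemma integrable_continuousM a b (h f : R -> R) : continuous h ->
  mu.-integrable `[a, b] (EFin \o f) ->
  mu.-integrable `[a, b] (EFin \o (fun t => f t * h t)).
Proof.
move=> ch intf.
rewrite (_ : _ \o _ = ((EFin \o f) \* (EFin \o h))%E); last first.
  by apply/funext => t /=; rewrite EFinM.
apply: integrableMl => //.
  by apply: measurable_funTS; exact: continuous_measurable_fun.
have : compact (h @` `[a, b]%classic).
  apply: continuous_compact; last exact: segment_compact.
  exact: continuous_subspaceT.
move=> /compact_bounded[M [Mr hM]]; exists M; split => // x Mx t abt.
by apply: hM => //; exists t.
Qed.

Lemma cintegrable_continuousM a b F (w : R -> R) : ccontinuous F ->
  mu.-integrable `[a, b] (EFin \o w) ->
  cintegrable `[a, b] (fun t => F t * (w t)%:C).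
Proof.
move=> [F1 F2] intw; split.
  under [X in _.-integrable _ X]eq_fun do
    rewrite cReM /= mulr0 subr0 mulrC.
  exact: integrable_continuousM.
under [X in _.-integrable _ X]eq_fun do rewrite cImM /= mulr0 add0r mulrC.
exact: integrable_continuousM.
Qed.

End ComplexIntegral.

(** * The exponential on the unit circle and integration by parts against it *)

Section IntegrationByParts.
Context {R : realType}.
Notation mu := (@lebesgue_measure R).
Local Notation C := R[i].
Implicit Types (F f : R -> C).

Lemma expiD (x y : R) : expi (x + y) = expi x * expi y.
Proof. by apply/eqP; rewrite eq_complex /= cosD sinD eqxx addrC eqxx. Qed.

Lemma expiN (x : R) : expi (- x) = (expi x)^*%C.
Proof. by rewrite /expi cosN sinN. Qed.

Lemma expi0 : expi 0 = 1 :> C.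
Proof. by rewrite /expi cos0 sin0. Qed.

Lemma expiMn (n : nat) (x : R) : expi (n%:R * x) = expi x ^+ n.
Proof.
by elim: n => [|n IH];
  rewrite ?mul0r ?expi0// -natr1 mulrDl mul1r expiD IH exprSr.
Qed.

Lemma expi2pi : expi (2 * pi) = 1 :> C.
Proof. by rewrite /expi mulr2n mulrDl mul1r -mulr2n cos2pi sin2pi. Qed.

Lemma expiMJ (x : R) : expi x * (expi x)^*%C = 1.
Proof. by rewrite -expiN -expiD subrr expi0. Qed.

Lemma expi_neq0 (x : R) : expi x != 0.
Proof.
by apply/eqP => h; have := expiMJ x; rewrite h mul0r => /esym/eqP;
  rewrite oner_eq0.
Qed.

(** On the unit circle the reflected point 1 / conj z is z itself. *)
Lemma horner_reversed_expi n (p : {poly C}) (x : R) : (size p <= n.+1)%N ->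
  (reversed n p).[expi x] = expi x ^+ n * (p.[expi x])^*%C.
Proof.
move=> sp; rewrite horner_reversed ?expi_neq0//.
suff -> : ((expi x)^*%C)^-1 = expi x by [].
apply: (mulIf (x := (expi x)^*%C)); first by rewrite conjc_eq0 expi_neq0.
by rewrite expiMJ mulVf// conjc_eq0 expi_neq0.
Qed.

Lemma absolutely_continuous_on_Re a b F : absolutely_continuous_on a b F ->
  real_AC a b (fun t => complex.Re (F t)).
Proof.
move=> acF e e0; have [d d0 dF] := acF e e0; exists d => // n u v uv tuv sd.
rewrite -ltcR; apply: le_lt_trans (dF n u v uv tuv sd).
rewrite rmorph_sum /=; apply: ler_sum => k _.
by rewrite (_ : _ - _ = complex.Re (F (v k) - F (u k))) ?normc_ge_Re//;
  case: (F _) (F _) => ? ? [].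
Qed.

Lemma absolutely_continuous_on_Im a b F : absolutely_continuous_on a b F ->
  real_AC a b (fun t => complex.Im (F t)).
Proof.
move=> acF e e0; have [d d0 dF] := acF e e0; exists d => // n u v uv tuv sd.
rewrite -ltcR; apply: le_lt_trans (dF n u v uv tuv sd).
rewrite rmorph_sum /=; apply: ler_sum => k _.
(* Multiplication by -i has modulus 1 and turns the imaginary part into a real part. *)
rewrite (_ : _ - _ = complex.Re (- 'i%C * (F (v k) - F (u k)))); last first.
  by case: (F _) (F _) => a1 b1 [a2 b2] /=; ring.
apply: le_trans (normc_ge_Re _) _; rewrite normrM normrN.
by rewrite [`|'i%C|]normc_def /= expr0n expr1n add0r sqrtr1 mul1r.
Qed.

(** The integrand is the derivative of F(t) e^(irt). Its real and imaginary parts are combinations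
    of Re F and Im F times cosine and sine, so the real theorem applies to each. *)
Lemma integral_by_parts_expi b (r : R) F f : 0 <= b ->
  absolutely_continuous_on 0 b F ->
  cintegrable `[0, b] F -> cintegrable `[0, b] f ->
  {ae mu, forall t, `[0, b]%classic t -> is_cderive F t (f t)} ->
  cintegral `[0, b] (fun t => (f t + 'i%C * r%:C * F t) * expi (r * t)) =
  F b * expi (r * b) - F 0 * expi (r * 0).
Proof.
move=> b0 acF [iF1 iF2] [if1 if2] aeF.
have acF1 := absolutely_continuous_on_Re acF.
have acF2 := absolutely_continuous_on_Im acF.
pose F1 t := complex.Re (F t); pose F2 t := complex.Im (F t).
pose f1 t := complex.Re (f t); pose f2 t := complex.Im (f t).
have ae1 : {ae mu, forall t, `[0, b]%classic t -> is_derive t 1 F1 (f1 t)}.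
  move: aeF; apply: filterS; first exact: (ae_filter_ringOfSetsType mu).
  by move=> t h /h[].
have ae2 : {ae mu, forall t, `[0, b]%classic t -> is_derive t 1 F2 (f2 t)}.
  move: aeF; apply: filterS; first exact: (ae_filter_ringOfSetsType mu).
  by move=> t h /h[].
pose c t := cos (r * t); pose s t := sin (r * t).
have c1 t : `|c t| <= 1 by rewrite ler_norml cos_geN1 cos_le1.
have s1 t : `|s t| <= 1 by rewrite ler_norml sin_geN1 sin_le1.
have dc (t : R) : is_derive t 1 c (- (r * s t)).
  by apply: is_derive_eq; rewrite /GRing.scale/= /c /s; ring.
have ds (t : R) : is_derive t 1 s (r * c t).
  by apply: is_derive_eq; rewrite /GRing.scale/= /c /s; ring.
have cc : continuous c by move=> t; apply: differentiable_continuous;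
  apply/derivable1_diffP; have dct := dc t; exact: ex_derive.
have cs : continuous s by move=> t; apply: differentiable_continuous;
  apply/derivable1_diffP; have dst := ds t; exact: ex_derive.
have Kc t : `|- (r * s t)| <= `|r| by rewrite normrN normrM ler_piMr.
have Ks t : `|r * c t| <= `|r| by rewrite normrM ler_piMr.
have parts G g h k : real_AC 0 b G -> mu.-integrable `[0, b] (EFin \o g) ->
  {ae mu, forall x, `[0, b]%classic x -> is_derive x 1 G (g x)} ->
  (forall x, `|h x| <= 1) -> (forall x, `|k x| <= `|r|) ->
  (forall x : R, is_derive x 1 h (k x)) -> _ :=
  @real_ACM_smooth R 0 b G g h k `|r| b0 (normr_ge0 r).
have [A11 D11] := parts _ _ _ _ acF1 if1 ae1 c1 Kc dc.
have [A12 D12] := parts _ _ _ _ acF1 if1 ae1 s1 Ks ds.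
have [A21 D21] := parts _ _ _ _ acF2 if2 ae2 c1 Kc dc.
have [A22 D22] := parts _ _ _ _ acF2 if2 ae2 s1 Ks ds.
have intM h g := @integrable_continuousM R 0 b h g.
have intD (g h : R -> R) : mu.-integrable `[0, b] (EFin \o g) ->
    mu.-integrable `[0, b] (EFin \o h) ->
    mu.-integrable `[0, b] (EFin \o (fun t => g t + h t)).
  by move=> ? ?; rewrite (_ : _ \o _ = (EFin \o g) \+ (EFin \o h))%E//;
    exact: integrableD.
have cks : continuous (fun t => r * c t).
  by move=> t; apply: cvgM; [exact: cvg_cst|exact: cc].
have ckc : continuous (fun t => - (r * s t)).
  by move=> t; apply: cvgN; apply: cvgM; [exact: cvg_cst|exact: cs].
have intN (g : R -> R) : mu.-integrable `[0, b] (EFin \o g) ->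
    mu.-integrable `[0, b] (EFin \o (fun t => - g t)).
  by move=> ?; rewrite (_ : _ \o _ = -%E \o (EFin \o g))%E//;
    exact: integrableN.
(* [I1] is the real part of the claim, [I2] below the imaginary part. *)
have I1 : \int[mu]_(t in `[0, b]) (f1 t * c t + F1 t * - (r * s t)
     + - (f2 t * s t + F2 t * (r * c t))) =
     (F1 b * c b + - (F2 b * s b)) - (F1 0 * c 0 + - (F2 0 * s 0)).
  apply: (@real_AC_FTC _ 0 b (fun t => F1 t * c t + - (F2 t * s t))) => //.
  - exact: real_ACD A11 (real_ACN A22).
  - apply: (intD); [|apply: (intN)]; by apply: intD; apply: intM.
  - move: D11 D22; apply: filterS2; first exact: (ae_filter_ringOfSetsType mu).
    move=> t h1 h2 tb; have {}h1 := h1 tb; have {}h2 := h2 tb.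
    exact: is_deriveB.
have I2 : \int[mu]_(t in `[0, b]) (f1 t * s t + F1 t * (r * c t)
     + (f2 t * c t + F2 t * - (r * s t))) =
     (F1 b * s b + F2 b * c b) - (F1 0 * s 0 + F2 0 * c 0).
  apply: (@real_AC_FTC _ 0 b (fun t => F1 t * s t + F2 t * c t)) => //.
  - exact: real_ACD A12 A21.
  - by apply: (intD); apply: intD; apply: intM.
  - move: D12 D21; apply: filterS2; first exact: (ae_filter_ringOfSetsType mu).
    move=> t h1 h2 tb; have {}h1 := h1 tb; have {}h2 := h2 tb.
    exact: is_deriveD.
apply/eqP; rewrite eq_complex /=; apply/andP; split; apply/eqP.
  transitivity (F1 b * c b + - (F2 b * s b) - (F1 0 * c 0 + - (F2 0 * s 0))).
    rewrite -I1; apply: eq_Rintegral => t _.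
    by rewrite !(cReM, cImM, cReD, cImD)/= -/(F1 t) -/(F2 t) -/(f1 t) -/(f2 t)
      -/(c t) -/(s t); ring.
  by rewrite /F1 /F2 /c /s; case: (F b) (F 0) => x1 y1 [x2 y2] /=; ring.
transitivity (F1 b * s b + F2 b * c b - (F1 0 * s 0 + F2 0 * c 0)).
  rewrite -I2; apply: eq_Rintegral => t _.
  by rewrite !(cReM, cImM, cReD, cImD)/= -/(F1 t) -/(F2 t) -/(f1 t) -/(f2 t)
    -/(c t) -/(s t); ring.
by rewrite /F1 /F2 /c /s; case: (F b) (F 0) => x1 y1 [x2 y2] /=; ring.
Qed.

End IntegrationByParts.

(** Brings cubics such as [A] into the form that [ip_cubicM] expands. *)
Lemma poly_size4 (K : nzRingType) (p : {poly K}) : (size p <= 4)%N ->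
  p = p`_0 *: 1 + p`_1 *: 'X + p`_2 *: 'X^2 + p`_3 *: 'X^3.
Proof.
move=> sp; apply/polyP => i; rewrite !coefD !coefZ coef1 coefX !coefXn.
by case: i => [|[|[|[|i]]]];
  rewrite /= ?mulr1 ?mulr0 ?addr0 ?add0r// nth_default// (leq_trans sp).
Qed.

(** * The inner product on polynomials: sesquilinearity, shifts, reversal, definiteness *)

Section InnerProduct.
Context {R : realType} (w : R -> R).
Hypothesis hw : weight w.
Notation mu := (@lebesgue_measure R).
Local Notation C := R[i].
Local Notation I := `[0, 2 * pi]%classic.
Implicit Types (p q : {poly C}) (z : C).

Definition ip p q : C := inner w (horner p) (horner q).

Lemma ip_cintegrable p q :
  cintegrable I (fun t => p.[expi t] * (q.[expi t])^*%C * (w t)%:C).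
Proof.
apply: cintegrable_continuousM; last exact: hw.1.
apply: ccontinuousM; first exact: ccontinuous_horner.
by apply: ccontinuousJ; exact: ccontinuous_horner.
Qed.

(** Allows identities that hold only on the unit circle, such as z conj z = 1. *)
Lemma eq_ip p q p' q' :
  (forall t : R,
    p.[expi t] * (q.[expi t])^*%C = p'.[expi t] * (q'.[expi t])^*%C) ->
  ip p q = ip p' q'.
Proof. by move=> h; apply: eq_cintegral => t _; rewrite h. Qed.

Lemma ipDl p p' q : ip (p + p') q = ip p q + ip p' q.
Proof.
rewrite /ip /inner -cintegralD//; try exact: ip_cintegrable.
by apply: eq_cintegral => t _; rewrite hornerD; ring.
Qed.

Lemma ipZl z p q : ip (z *: p) q = z * ip p q.
Proof.
rewrite /ip /inner -cintegralZ//; try exact: ip_cintegrable.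
by apply: eq_cintegral => t _; rewrite hornerZ -!mulrA.
Qed.

Lemma ipJ p q : (ip p q)^*%C = ip q p.
Proof.
rewrite /ip /inner -cintegralJ//; try exact: ip_cintegrable.
apply: eq_cintegral => t _.
by rewrite !cMJ conjcK conjc_real; ring.
Qed.

Lemma ipNl p q : ip (- p) q = - ip p q.
Proof. by rewrite -scaleN1r ipZl mulN1r. Qed.

Lemma ipBl p p' q : ip (p - p') q = ip p q - ip p' q.
Proof. by rewrite ipDl ipNl. Qed.

Lemma ip0l q : ip 0 q = 0.
Proof. by rewrite -(scale0r 0) ipZl mul0r. Qed.

Lemma ip_suml (J : finType) (f : J -> {poly C}) q :
  ip (\sum_i f i) q = \sum_i ip (f i) q.
Proof.
apply: (big_ind2 (fun x y => ip x q = y)) => // [|x y x' y' <- <-].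
  exact: ip0l.
exact: ipDl.
Qed.

Lemma ip_sumr (J : finType) (f : J -> {poly C}) q :
  ip q (\sum_i f i) = \sum_i ip q (f i).
Proof.
by rewrite -ipJ ip_suml rmorph_sum; apply: eq_bigr => i _; exact: ipJ.
Qed.

Lemma ipZr z p q : ip p (z *: q) = z^*%C * ip p q.
Proof. by rewrite -ipJ ipZl cMJ ipJ. Qed.

Lemma ipDr p q q' : ip p (q + q') = ip p q + ip p q'.
Proof. by rewrite -ipJ ipDl cDJ !ipJ. Qed.

Lemma ipNr p q : ip p (- q) = - ip p q.
Proof. by rewrite -ipJ ipNl cNJ ipJ. Qed.

Lemma ip_orthogonal_poly p q n : (size q <= n)%N ->
  (forall k, (k < n)%N -> ip p 'X^k = 0) -> ip p q = 0.
Proof.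
move=> sq h; rewrite -[q]coefK poly_def ip_sumr big1// => i _.
by rewrite ipZr h ?mulr0// (leq_trans _ sq).
Qed.

(** Multiplication by z^k is an isometry because |z| = 1 on the circle. *)
Lemma ip_shift k p q : ip ('X^k * p) ('X^k * q) = ip p q.
Proof.
apply: eq_ip => t; rewrite !hornerM hornerXn cMJ cXJ.
by rewrite mulrACA -exprMn expiMJ expr1n mul1r.
Qed.

Lemma ipXX p q : ip ('X * p) ('X * q) = ip p q.
Proof. by rewrite -['X]expr1 ip_shift. Qed.

Lemma ip_shiftX i k p : ip ('X^(i + k) * p) 'X^k = ip ('X^i * p) 1.
Proof. by rewrite -[RHS](ip_shift k) mulr1 addnC exprD mulrA. Qed.

Lemma ip_cubicM (c0 c1 c2 c3 : C) p q :
  ip ((c0 *: 1 + c1 *: 'X + c2 *: 'X^2 + c3 *: 'X^3) * p) q =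
  c0 * ip ('X^0 * p) q + c1 * ip ('X^1 * p) q + c2 * ip ('X^2 * p) q +
  c3 * ip ('X^3 * p) q.
Proof. by rewrite !mulrDl -!scalerAl !ipDl !ipZl. Qed.

(** On the circle the reversed polynomial is z^n conj p(z), and conj(z^m) cancels m powers of z; m
    <= n + k keeps the exponent natural. *)
Lemma ip_reversed n k m p : (size p <= n.+1)%N -> (m <= n + k)%N ->
  ip ('X^k * reversed n p) 'X^m = ip 'X^(n + k - m) p.
Proof.
move=> sp mnk; rewrite -(ip_shift m 'X^_) -exprD subnKC//.
apply: eq_ip => t; rewrite !hornerM !hornerXn horner_reversed_expi//.
by rewrite cMJ !cXJ exprD; ring.
Qed.

(* If |p|^2 w has integral 0 then p vanishes almost everywhere on the upper half
   circle, where it could only have finitely many zeros. *)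
Lemma ip_definite p : ip p p = 0 -> p = 0.
Proof.
move=> pp0; apply: contrapT => /eqP pn0.
pose h (t : R) := complex.Re (p.[expi t] * (p.[expi t])^*%C).
have h0 t : 0 <= h t.
  by have := mulcJ_ge0 p.[expi t]; rewrite lecE => /andP[].
have [i1 _] := ip_cintegrable p p.
have hE t : complex.Re (p.[expi t] * (p.[expi t])^*%C * (w t)%:C) = h t * w t.
  by rewrite cReM/= mulr0 subr0.
have ih : mu.-integrable I (EFin \o (fun t => h t * w t)).
  by apply: eq_integrable i1 => // t _ /=; rewrite hE.
have int0 : (\int[mu]_(t in I) (h t * w t)%:E = 0)%E.
  rewrite -[LHS]fineK; last exact: integrable_fin_num.
  by move: pp0 => [] + _; rewrite /Rintegral; under eq_integral do rewrite hE;
    move=> ->.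
(* The integrand h w is nonnegative almost everywhere with integral 0, and w > 0 almost
   everywhere. *)
have aeh : {ae mu, forall t, I t -> h t = 0}.
  have mI : measurable (I : set R) by [].
  have [mh _] := integrableP _ _ _ ih.
  have [+ _] := ae_eq_integral_abs mu mI mh.
  have aepos : {ae mu, forall t : R,
      I t -> abse (h t * w t)%:E = (h t * w t)%:E}.
    have := hw.2; apply: filterS; first exact: (ae_filter_ringOfSetsType mu).
    by move=> t wt It /=; rewrite ger0_norm// mulr_ge0// ltW// wt.
  have -> : (\int[mu]_(t in I) `|(EFin \o (fun t => (h t * w t)%R)) t| =
    \int[mu]_(t in I) (h t * w t)%:E)%E.
    by apply: ae_eq_integral => //; exact: measurableT_comp.
  move=> /(_ int0) aehw; have := hw.2; move: aehw.
  apply: filterS2 => t h1 h2 It; have [/eqP] := h1 It.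
  by rewrite mulf_eq0 (gt_eqF (h2 It)) orbF => /eqP.
(* On [0, pi] [acos] recovers the angle from the real part, so finitely many roots give finitely
   many angles. *)
pose Z := [set t : R | `[0, pi]%classic t /\ root p (expi t)].
have finZ : finite_set Z.
  have [r pE] := closed_field_poly_normal p.
  apply: sub_finite_set (finite_image (fun z => acos (complex.Re z))
    (finite_seq r)).
  move=> t [tpi]; rewrite pE rootZ ?lead_coef_eq0// root_prod_XsubC => tr.
  by exists (expi t) => //=; rewrite cosK.
have Z0 : mu Z = 0%E by apply: countable_lebesgue_measure0;
  exact: finite_set_countable.
(* Outside [Z] the function [h] is nonzero, so two null sets would cover an interval of length
   pi. *)
have : mu.-negligible `[0, pi]%classic.
  have nZ : mu.-negligible Z.
    apply/negligibleP => //; apply: countable_measurable;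
      last exact: finite_set_countable.
    by move=> t; exact: measurable_set1.
  apply: negligibleS (negligibleU aeh nZ) => t tpi.
  have [tZ|tZ] := pselect (Z t); [by right|left => /=].
  apply: contra_not tZ => hI; have ht : h t = 0.
    apply: hI; move: tpi; rewrite /= !in_itv/= => /andP[-> /le_trans]; apply.
    by rewrite mulr2n mulrDl mul1r lerDl pi_ge0.
  split => //; apply/rootP/eqP; rewrite -normr_eq0 -sqrf_eq0 sqr_normc.
  have := mulcJ_ge0 p.[expi t]; rewrite lecE => /andP[/eqP im _].
  by rewrite eq_complex [X in X == _]ht im !eqxx.
move=> /negligibleP => /(_ (measurable_itv _)).
rewrite [X in X = _ -> _]lebesgue_measure_itv/= lte_fin pi_gt0 -EFinB subr0 =>
  -[]/eqP.
by rewrite gt_eqF// pi_gt0.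
Qed.
End InnerProduct.

(** * Moment identities from the Pearson equation *)

Section PearsonMoments.
Context {R : realType} (w : R -> R).
Hypothesis hw : weight w.
Local Notation C := R[i].
Local Notation ip := (ip w).

(** Integration by parts for A w at the integer frequency m - j: e^(irt) is 1 at both ends, so the
    boundary term is the one assumed to vanish. Hence B + i(m - j)A times z^m is orthogonal to
    z^j. *)
Lemma pearson_moment (A B : {poly C}) : pearson A B w ->
  A.[1] * (w (2 * pi) - w 0)%:C = 0 -> forall m j : nat,
  'i%C * ip (B * 'X^m) 'X^j = (m%:R - j%:R) * ip (A * 'X^m) 'X^j.
Proof.
move=> [acAw aeAw] hb m j.
pose F (t : R) := A.[expi t] * (w t)%:C.
pose f (t : R) := B.[expi t] * (w t)%:C.
pose r : R := m%:R - j%:R.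
have expir t : expi (r * t) = expi t ^+ m * (expi t)^*%C ^+ j :> C.
  by rewrite mulrBl expiD expiN !expiMn cXJ.
have pi0 : 0 <= 2 * pi :> R by rewrite mulr_ge0// pi_ge0.
have iF : cintegrable `[0, 2 * pi] F.
  by apply: cintegrable_continuousM (ccontinuous_horner _) hw.1.
have if_ : cintegrable `[0, 2 * pi] f.
  by apply: cintegrable_continuousM (ccontinuous_horner _) hw.1.
have := integral_by_parts_expi r pi0 acAw iF if_ aeAw.
rewrite !expir expi2pi expi0 conjc1 !expr1n !mulr1 -mulrBr -rmorphB /= hb =>
  int0.
have rC : r%:C = m%:R - j%:R by rewrite rmorphB /= !rmorph_nat.
have : ip ((B + ('i%C * r%:C) *: A) * 'X^m) 'X^j = 0.
  rewrite -int0; apply: eq_cintegral => t _.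
  by rewrite expir !hornerM hornerD hornerZ !hornerXn cXJ /F /f; ring.
rewrite mulrDl -scalerAl (ipDl hw) (ipZl hw) rC => /eqP;
  rewrite addr_eq0 => /eqP ->.
by rewrite mulrN !mulrA -expr2 sqr_i; ring.
Qed.

(** By linearity f = z^m. The moment identity with j = k+1 trades iB for (m-k-1)A, leaving m A z^m
    on the right, and a shift by one power of z gives A f'. *)
Lemma pearson_ip_deriv (A B f : {poly C}) k : pearson A B w ->
  A.[1] * (w (2 * pi) - w 0)%:C = 0 ->
  ip (A * f^`()%R) 'X^k = ip ((k.+1%:R *: A + 'i%C *: B) * f) 'X^(k.+1).
Proof.
move=> hAB hb.
rewrite -[f]coefK poly_def raddf_sum /= !mulr_sumr !(ip_suml hw).
apply: eq_bigr => m _; rewrite derivZ -!scalerAr !(ipZl hw); congr (_ * _).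
rewrite mulrDl -!scalerAl (ipDl hw) !(ipZl hw) (pearson_moment hAB hb).
rewrite derivXn mulrnAr -scaler_nat (ipZl hw).
have -> : m%:R * ip (A * 'X^(m.-1)) 'X^k = m%:R * ip (A * 'X^m) 'X^(k.+1) :> C.
  case: (m : nat) => [|m']; first by rewrite !mul0r.
  by congr (_ * _); rewrite -ipXX /= mulrCA -!exprS.
by ring.
Qed.

End PearsonMoments.

(** * Orthogonal polynomials: the Szego recursion and inner products with monomials *)

Section OPUC.
Context {R : realType} (w : R -> R) (Phi : nat -> {poly R[i]}).
Hypothesis hw : weight w.
Hypothesis hPhi : monic_OPUC w Phi.
Local Notation C := R[i].
Local Notation ip := (ip w).
Local Notation alpha := (verblunsky Phi).
Implicit Types (p q : {poly C}).

Lemma size_Phi n : size (Phi n) = n.+1.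
Proof. by have [/(_ n)[]] := hPhi. Qed.

Lemma Phi_lead n : (Phi n)`_n = 1.
Proof. by have [/(_ n)[/monicP]] := hPhi; rewrite lead_coefE size_Phi. Qed.

(** Strong induction: z^k differs from Phi_k, which is orthogonal to Phi_n, by a polynomial of
    degree below k. *)
Lemma Phi_orth_Xn n k : (k < n)%N -> ip (Phi n) 'X^k = 0.
Proof.
elim/ltn_ind: k => k IH kn.
rewrite -(subrK (Phi k) 'X^k) (ipDr hw).
rewrite [X in _ + X]hPhi.2; last by rewrite gt_eqF.
rewrite addr0; apply: (ip_orthogonal_poly hw (n := k)) => [|j jk].
  apply/leq_sizeP => j; rewrite leq_eqVlt coefB coefXn => /predU1P[<-|kj].
    by rewrite eqxx Phi_lead subrr.
  by rewrite gt_eqF// nth_default ?subrr// size_Phi.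
by apply: IH => //; exact: ltn_trans kn.
Qed.

Lemma Phi_orth n p : (size p <= n)%N -> ip (Phi n) p = 0.
Proof.
by move=> sp; apply: (ip_orthogonal_poly hw sp) => k; exact: Phi_orth_Xn.
Qed.

(** The squared norm, not the leading coefficient of the orthonormal polynomial that often bears
    this letter. *)
Definition kappa n : C := ip (Phi n) (Phi n).

Lemma kappaJ n : (kappa n)^*%C = kappa n.
Proof. exact: ipJ. Qed.

Lemma Phi_ip_monic n p : size p = n.+1 -> p`_n = 1 -> ip (Phi n) p = kappa n.
Proof.
move=> sp pn; rewrite -(subrK (Phi n) p) (ipDr hw) Phi_orth ?add0r//.
apply/leq_sizeP => j; rewrite leq_eqVlt coefB => /predU1P[<-|nj].
  by rewrite pn Phi_lead subrr.
by rewrite !nth_default ?subrr// ?size_Phi ?sp.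
Qed.

Lemma Phi_ip_Xn n : ip (Phi n) 'X^n = kappa n.
Proof. by apply: Phi_ip_monic; rewrite ?size_polyXn// coefXn eqxx. Qed.

Local Notation star n := (reversed n (Phi n)).

(** Reversal turns the left side into the product of z^(n-m) with Phi_n. *)
Lemma star_ip n m : (m <= n)%N -> ip (star n) 'X^m = (m == 0)%:R * kappa n.
Proof.
move=> mn; have := @ip_reversed _ w n 0 m (Phi n).
rewrite size_Phi addn0 expr0 mul1r => -> //; rewrite -(ipJ hw).
case: eqP => [->|/eqP m0]; first by rewrite subn0 Phi_ip_Xn kappaJ mul1r.
by rewrite Phi_orth_Xn ?conjc0 ?mul0r// ltn_subrL lt0n m0 (leq_trans _ mn)//
  lt0n.
Qed.

Lemma alphaJ n : (alpha n)^*%C = - (Phi n.+1)`_0.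
Proof. by rewrite /verblunsky horner_coef0 cNJ conjcK. Qed.

Lemma star_coef0 n : (star n)`_0 = 1.
Proof. by rewrite coef_poly subn0 Phi_lead conjc1. Qed.

(* The difference of both sides is z times a polynomial of degree < n
   orthogonal to itself. *)
Lemma szego n : Phi n.+1 = 'X * Phi n - (alpha n)^*%C *: star n.
Proof.
pose D := 'X * Phi n - (alpha n)^*%C *: star n - Phi n.+1.
have D0 : D`_0 = 0.
  by rewrite !coefB coefZ star_coef0 coefXM/= alphaJ; ring.
have sD : (size D <= n.+1)%N.
  apply/leq_sizeP => j;
    rewrite leq_eqVlt !coefB coefZ coefXM coef_poly => /predU1P[<-|nj].
    by rewrite ltnn mulr0 !Phi_lead; ring.
  rewrite ltnNge ltnW//= mulr0 [(Phi n.+1)`_j]nth_default ?size_Phi//.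
  by case: j nj => //= j nj; rewrite nth_default ?size_Phi// !subr0.
pose E := \poly_(k < n) D`_k.+1.
have DE : D = 'X * E.
  apply/polyP => -[|j]; first by rewrite coefXM D0.
  rewrite coefXM /= coef_poly; case: ltnP => // nj.
  by rewrite nth_default// (leq_trans sD).
have E0 : E = 0.
  apply: (ip_definite hw); apply: (ip_orthogonal_poly hw (n := n)) => [|k kn].
    exact: size_poly.
  (* Testing [E] against z^k is testing [D] against z^(k+1) with 1 <= k+1 <= n, where each of its
     three terms vanishes. *)
  rewrite -ipXX -DE -exprS !(ipBl hw) (ipZl hw).
  rewrite star_ip// mul0r mulr0 subr0 Phi_orth_Xn// subr0.
  by rewrite exprS ipXX Phi_orth_Xn.
by apply/eqP; rewrite eq_sym -subr_eq0 -/D DE E0 mulr0.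
Qed.

(** Pair the recursion with 1, to which Phi_(n+1) is orthogonal. *)
Lemma XPhi_ip1 n : ip ('X * Phi n) 1 = (alpha n)^*%C * kappa n.
Proof.
have := @Phi_orth_Xn n.+1 0 (ltn0Sn _).
rewrite szego (ipBl hw) (ipZl hw) star_ip// mul1r => /eqP.
by rewrite subr_eq0 => /eqP <-; rewrite expr0.
Qed.

Lemma star_ip_XSn n : ip (star n) 'X^(n.+1) = alpha n * kappa n.
Proof.
rewrite -[LHS](ipJ hw) -[RHS]conjcK cMJ kappaJ -XPhi_ip1; congr (_^*)%C.
(* On the circle both integrands equal conj(z Phi_n(z)). *)
apply: eq_ip => t.
rewrite hornerXn hornerM hornerX horner_reversed_expi ?size_Phi//.
rewrite cMJ cXJ conjcK -[1 in RHS]polyC1 hornerC conjc1 mulr1.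
by rewrite mulrA exprS -(mulrA (expi t)) -exprMn expiMJ expr1n mulr1.
Qed.

(** Pair the recursion with z^(n+1). *)
Lemma kappaS n : kappa n.+1 = kappa n * (1 - `|alpha n| ^+ 2).
Proof.
rewrite -[LHS](Phi_ip_Xn n.+1) szego (ipBl hw) (ipZl hw) star_ip_XSn sqr_normc.
by rewrite exprS ipXX Phi_ip_Xn; ring.
Qed.

Lemma Phi_ip_XSn n : ip (Phi n) 'X^(n.+1) = - ((Phi n.+1)`_n)^*%C * kappa n.
Proof.
(* The coefficients of z^(n+1) and z^n cancel, leaving degree below n. *)
have /eqP : ip (Phi n) ('X^(n.+1) - Phi n.+1 + (Phi n.+1)`_n *: 'X^n) = 0.
  apply: Phi_orth; apply/leq_sizeP => j nj; rewrite coefD coefB coefZ !coefXn.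
  have [->|jn] := eqVneq j n; first by rewrite eqn_leq ltnn andbF /=; ring.
  have [->|jn1] := eqVneq j n.+1; first by rewrite Phi_lead /=; ring.
  rewrite nth_default ?size_Phi; first by rewrite /=; ring.
  by rewrite ltn_neqAle eq_sym jn1 ltn_neqAle eq_sym jn.
have o : ip (Phi n) (Phi n.+1) = 0 by apply: hPhi.2; rewrite ltn_eqF.
rewrite !(ipDr hw) (ipNr hw) (ipZr hw) Phi_ip_Xn o subr0.
by rewrite addr_eq0 => /eqP ->; rewrite mulNr.
Qed.

Lemma Xstar_ip1 n : ip ('X * star n) 1 = - (Phi n.+1)`_n * kappa n.
Proof.
have := @ip_reversed _ w n 1 0 (Phi n); rewrite size_Phi expr0 expr1 => -> //.
by rewrite addn1 subn0 -(ipJ hw) Phi_ip_XSn cMJ cNJ conjcK kappaJ.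
Qed.

Lemma X2Phi_ip1 n : ip ('X^2 * Phi n) 1 =
  (alpha n.+1)^*%C * kappa n.+1 - (alpha n)^*%C * (Phi n.+1)`_n * kappa n.
Proof.
have -> : 'X^2 * Phi n = 'X * Phi n.+1 + (alpha n)^*%C *: ('X * star n).
  by rewrite [Phi n.+1]szego mulrBr scalerAr subrK expr2 mulrA.
by rewrite (ipDl hw) (ipZl hw) XPhi_ip1 Xstar_ip1; ring.
Qed.

(** Coefficient of z^(n+1) in the recursion; the top coefficient of [star n.+1] is conj
    Phi_(n+1)(0), that is, [- alpha n]. *)
Lemma Phi_subleading n : (Phi n.+2)`_n.+1 =
  (Phi n.+1)`_n + (alpha n.+1)^*%C * alpha n.
Proof.
rewrite szego coefB coefZ coefXM /= coef_poly ltnSn subnn.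
by rewrite {3}/verblunsky horner_coef0; ring.
Qed.

Lemma ip_XjPhi n j k : (j <= k)%N -> (k < n + j)%N ->
  ip ('X^j * Phi n) 'X^k = 0.
Proof.
move=> jk kn; rewrite -(subnKC jk) exprD ip_shift Phi_orth_Xn//.
by rewrite ltn_subLR// addnC.
Qed.

Lemma star_ip_X n m : (m < n)%N ->
  ip ('X * star n) 'X^(m.+1) = (m == 0)%:R * kappa n.
Proof. by move=> mn; rewrite exprS ipXX star_ip// ltnW. Qed.

End OPUC.

(** * The structure relation, by matching top coefficients and inner products with monomials *)

Theorem theorem2p1 (R : realType) (A B : {poly R[i]}) (w : R -> R)
    (Phi : nat -> {poly R[i]})
    (hA : (size A <= 4)%N) (hB : (size B <= 4)%N)
    (hw : weight w) (hAB : pearson A B w)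
    (hbound : A.[1] * (w (2 * pi) - w 0)%:C = 0)
    (hPhi : monic_OPUC w Phi) (n : nat) (hn : (3 <= n)%N) :
  let a0 := A`_0%N in let a1 := A`_1%N in
  let a2 := A`_2%N in let a3 := A`_3%N in
  let b0 := B`_0%N in let b1 := B`_1%N in
  let b2 := B`_2%N in let b3 := B`_3%N in
  let l m k := (Phi m)`_k in
  let alpha := verblunsky Phi in
  let p_n := ('i%C * b3 + 2 * a3) * (alpha n)^*%C in
  let t_n := ('i%C * b3 + a3) * (alpha n.+1)^*%C * (1 - `|alpha n| ^+ 2)
             + ('i%C * b2 + a2 + a3 * l n.+1 n) * (alpha n)^*%C in
  let s_prev := ('i%C * b0 + n%:R * a0) * (1 - `|alpha n.-1| ^+ 2) in
  let s_same := 'i%C * b1 + n.+1%:R * a1 - a0 * (l n n.-1)^*%C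
                - ('i%C * b0 + n.+1%:R * a0) * alpha n * (alpha n.-1)^*%C in
  let s_next := n%:R * a2
                + a3 * ((n%:R - 1) * l n n.-1 - n%:R * l n.+2 n.+1)
                + ('i%C * b3 + 2 * a3) * (alpha n)^*%C * alpha n.-1 in
  A * (Phi n)^`() =
    (n%:R * a3) *: Phi n.+2 + s_next *: Phi n.+1 + s_same *: Phi n
    + s_prev *: Phi n.-1 + (p_n *: 'X + t_n%:P) * reversed n (Phi n).
Proof.
(* Now n = m+3, which keeps the exponents 0, 1, n-1 and n distinct. *)
case: n hn => [|[|[|m]]] // hn.
move=> a0 a1 a2 a3 b0 b1 b2 b3 l alpha p_n t_n s_prev s_same s_next.
rewrite /= in s_prev s_same s_next *.
have lhs k : ip w (A * (Phi m.+3)^`()) 'X^k =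
    (k.+1%:R * a0 + 'i%C * b0) * ip w ('X^0 * Phi m.+3) 'X^(k.+1) +
    (k.+1%:R * a1 + 'i%C * b1) * ip w ('X^1 * Phi m.+3) 'X^(k.+1) +
    (k.+1%:R * a2 + 'i%C * b2) * ip w ('X^2 * Phi m.+3) 'X^(k.+1) +
    (k.+1%:R * a3 + 'i%C * b3) * ip w ('X^3 * Phi m.+3) 'X^(k.+1).
  rewrite (pearson_ip_deriv hw _ k hAB hbound).
  set P := _ + _; have sP : (size P <= 4)%N.
    by rewrite (leq_trans (size_polyD _ _))// geq_max !(leq_trans
      (size_scale_leq _ _)).
  rewrite (poly_size4 sP) /P !coefD !coefZ -/a0 -/a1 -/a2 -/a3 -/b0 -/b1 -/b2
    -/b3.
  exact: (ip_cubicM hw).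
set rhs := (X in _ = X).
have rhsD : rhs = (m.+3%:R * a3) *: Phi m.+4.+1 + s_next *: Phi m.+4 +
    s_same *: Phi m.+3 + s_prev *: Phi m.+2 +
    p_n *: ('X * reversed m.+3 (Phi m.+3)) +
    t_n *: reversed m.+3 (Phi m.+3).
  by rewrite /rhs [(_ + _%:P) * _]mulrDl -scalerAl mul_polyC addrA.
have rhsE k : ip w rhs 'X^k =
    (m.+3%:R * a3) * ip w (Phi m.+4.+1) 'X^k + s_next * ip w (Phi m.+4) 'X^k +
    s_same * ip w (Phi m.+3) 'X^k + s_prev * ip w (Phi m.+2) 'X^k +
    p_n * ip w ('X * reversed m.+3 (Phi m.+3)) 'X^k +
    t_n * ip w (reversed m.+3 (Phi m.+3)) 'X^k.
  by rewrite rhsD !(ipDl hw) !(ipZl hw).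
pose D := A * (Phi m.+3)^`() - rhs.
have alphaN : ((Phi m.+3)`_0)^*%C = - alpha m.+2.
  by rewrite /alpha /verblunsky horner_coef0 opprK.
have sD : (size D <= m.+4)%N.
  have coefA i : (A * (Phi m.+3)^`())`_i = a0 * (Phi m.+3)^`()`_i +
      a1 * ('X * (Phi m.+3)^`())`_i + a2 * ('X^2 * (Phi m.+3)^`())`_i +
      a3 * ('X^3 * (Phi m.+3)^`())`_i.
    by rewrite {1}(poly_size4 hA) !mulrDl -!scalerAl !coefD !coefZ mul1r.
  have coefrhs i : rhs`_i = (m.+3%:R * a3) * (Phi m.+4.+1)`_i +
      s_next * (Phi m.+4)`_i + s_same * (Phi m.+3)`_i + s_prev * (Phi m.+2)`_i +
      p_n * ('X * reversed m.+3 (Phi m.+3))`_i +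
      t_n * (reversed m.+3 (Phi m.+3))`_i.
    by rewrite rhsD !coefD !coefZ.
  have nil k i : (k < i)%N -> (Phi k)`_i = 0.
    by move=> ki; rewrite nth_default// (size_Phi hPhi).
  apply/leq_sizeP => i;
    rewrite coefB coefA coefrhs coefXM !coefXnM !coef_deriv coefXM !coef_poly.
  (* Coefficient of z^(n+1), which determines [s_next]; the top coefficient of the reversed
     polynomial enters through [alphaN]. *)
  rewrite leq_eqVlt => /predU1P[<-|].
    rewrite /= !subSS !subn0 !(Phi_lead hPhi) ltnSn ltnn subnn alphaN.
    rewrite (nil m.+3 m.+4.+1)// (nil m.+3 m.+4)// (nil m.+2 m.+4)//.
    rewrite /s_next /p_n /l !mul0rn; ring.
  (* Coefficient of z^(n+2): both sides give n a_3. Beyond it everything is zero. *)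
  rewrite leq_eqVlt => /predU1P[<-|im].
    rewrite /= !subSS !subn0 !(Phi_lead hPhi).
    rewrite !ifF; try lia.
    by rewrite !nil ?mul0rn; try lia; ring.
  do 5! (case: i im => // i im).
  rewrite !ifF; try lia.
  by rewrite /= !subSS !subn0 !nil ?mul0rn; try lia; ring.
have kS := kappaS hw hPhi.
apply: subr0_eq; rewrite -/D.
have orth := Phi_orth_Xn hw hPhi.
have top := ip_XjPhi hw hPhi.
apply: (ip_definite hw); apply: (ip_orthogonal_poly hw sD) => k.
(* k = n determines [s_same]; [Phi_subleading] relates the subleading coefficients of Phi_(n+1) and
   Phi_n. *)
rewrite ltnS leq_eqVlt => /predU1P[->|].
  rewrite (ipBl hw) lhs rhsE mul1r (Phi_ip_XSn hw hPhi).
  rewrite (top _ 2)//; last by lia.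
  rewrite (top _ 3)//; last by lia.
  rewrite (exprS 'X m.+3) expr1 ipXX.
  rewrite (orth m.+4.+1)// (orth m.+4)// (star_ip_X hw hPhi)// (star_ip hw
    hPhi)//.
  rewrite (Phi_ip_XSn hw hPhi) (Phi_ip_Xn hw hPhi) (Phi_subleading hw hPhi).
  rewrite cDJ cMJ conjcK (kS m.+2) /=.
  rewrite /s_same /s_prev /l -/alpha; ring.
(* k = n-1 determines [s_prev], its last factor being the ratio of squared norms. *)
rewrite ltnS leq_eqVlt => /predU1P[->|].
  rewrite (ipBl hw) lhs rhsE mul1r !(Phi_ip_Xn hw hPhi).
  rewrite !top//; try lia.
  rewrite (orth m.+4.+1) ?(orth m.+4) ?(orth m.+3)//; try lia.
  rewrite (star_ip hw hPhi)//.
  rewrite (star_ip_X hw hPhi)// (kS m.+2) /=.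
  rewrite /s_prev -/alpha; ring.
(* k = 0 determines [t_n]: only the a_2, b_2, a_3, b_3 terms survive on the left. *)
case: k => [_|].
  rewrite (ipBl hw) lhs rhsE.
  rewrite (top _ 0)// (top _ 1)//; try lia.
  rewrite (ip_shiftX _ 1 1) (ip_shiftX _ 2 1) (XPhi_ip1 hw hPhi) (X2Phi_ip1 hw
    hPhi).
  rewrite !orth ?(star_ip hw hPhi)//; try lia.
  rewrite expr0 (Xstar_ip1 hw hPhi) (kS m.+3) /=.
  rewrite /t_n /p_n /l -/alpha; ring.
(* k = 1 determines [p_n]: only the a_3, b_3 term survives on the left. *)
case=> [n1|k kn].
  rewrite (ipBl hw) lhs rhsE.
  rewrite (top _ 0)// ?(top _ 1)// ?(top _ 2)//; try lia.
  rewrite (ip_shiftX _ 1 2) (XPhi_ip1 hw hPhi).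
  rewrite !orth ?(star_ip_X hw hPhi) ?(star_ip hw hPhi)//; try lia.
  rewrite /p_n -/alpha /=; ring.
(* The exponent is now k+2, between 2 and n-2, and every term vanishes. *)
rewrite (ipBl hw) lhs rhsE.
rewrite !top; try lia.
rewrite !orth ?(star_ip_X hw hPhi) ?(star_ip hw hPhi); try lia.
rewrite /=; ring.
Qed.
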